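(* Fix $h\in(0,1]$ and $\Delta t>0$, and let the sequence $(X_h^j, j\in\mathbb{N}_0)$ of $V_h$-valued random variables be given by the recursion $$X_h^{j+1} = D^{\mathrm{det}} X_h^j + D^{\mathrm{stoch},j} X_h^j,\qquad j\in\mathbb{N}_0,$$ where $D^{\mathrm{det}}\in L(V_h)$ is deterministic, the initial condition $X_h^0\in L^2(\Omega;V_h)$ is $\mathcal{F}_0$-measurable, and each $D^{\mathrm{stoch},j}$ is an $L(V_h)$-valued random variable such that for all $j\in\mathbb{N}_0$: (i) $D^{\mathrm{stoch},j}$ is $\mathcal{F}_{t_{j+1}}$-measurable and $\mathbb{E}[D^{\mathrm{stoch},j}\,|\,\mathcal{F}_{t_j}]=0$; (ii) $\mathbb{E}[\|D^{\mathrm{stoch},j}\|_{L(V_h)}^2]<\infty$; (iii) $\mathbb{E}[D^{\mathrm{stoch},j}\otimes D^{\mathrm{stoch},j}\,|\,\mathcal{F}_{t_j}]=\mathbb{E}[D^{\mathrm{stoch},j}\otimes D^{\mathrm{stoch},j}]$. Set $$\mathcal{S}_j = D^{\mathrm{det}}\otimes D^{\mathrm{det}} + \mathbb{E}[D^{\mathrm{stoch},j}\otimes D^{\mathrm{stoch},j}].$$ Then the zero solution of the recursion is asymptotically mean-square stable if $$\lim_{j\to\infty}\|\mathcal{S}_j\cdots\mathcal{S}_0\|_{L(V_h^{(2)})}=0.$$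
   Context: $(\Omega,\mathcal{A},(\mathcal{F}_t)_{t\ge0},P)$ is a complete filtered probability space satisfying the usual conditions; $H$ is a real separable Hilbert space; $V_h\subset H$ is a finite-dimensional subspace with the inner product and norm of $H$; $t_j=j\Delta t$. $L(V)$ denotes the bounded linear operators on $V$ with the operator norm. $V_h^{(2)}=V_h\otimes V_h$ is the Hilbert tensor product, with inner product determined by $\langle v_1\otimes v_2,w_1\otimes w_2\rangle=\langle v_1,w_1\rangle_H\langle v_2,w_2\rangle_H$; for $D_1,D_2\in L(V_h)$, $D_1\otimes D_2\in L(V_h^{(2)})$ is the operator with $(D_1\otimes D_2)(v\otimes w)=D_1v\otimes D_2w$. The zero solution of the recursion is $X_{h,\mathrm{e}}^j=0$ for all $j\in\mathbb{N}_0$. It is mean-square stable if for every $\varepsilon>0$ there is $\delta>0$ such that $\mathbb{E}[\|X_h^j\|_H^2]<\varepsilon$ for all $j\in\mathbb{N}_0$ whenever ($X_h^0\in L^2(\Omega;V_h)$ is $\mathcal{F}_0$-measurable and) $\mathbb{E}[\|X_h^0\|_H^2]<\delta$. It is asymptotically mean-square stable if it is mean-square stable and there is $\delta>0$ such that $\mathbb{E}[\|X_h^0\|_H^2]<\delta$ implies $\lim_{j\to\infty}\mathbb{E}[\|X_h^j\|_H^2]=0$. *)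

(* Defs.v *)
From HB Require Import structures.
From mathcomp Require Import all_boot all_order all_algebra.
From mathcomp Require Export sesquilinear.
From mathcomp Require Import all_classical all_reals all_analysis.

Set Implicit Arguments.
Unset Strict Implicit.
Unset Printing Implicit Defensive.

Import Order.TTheory GRing.Theory Num.Theory.
Import numFieldNormedType.Exports.

Local Open Scope classical_set_scope.
Local Open Scope ring_scope.

Definition separable_space (T : topologicalType) : Prop :=
  exists2 S : set T, countable S & dense S.

(* A finite-dimensional subspace of H is the image of an abstract
   finite-dimensional space under an injective linear map; in this way the
   operators on it, 'End(V), form again a vectType. *)
Record fsubspace (R : realType) (H : normedModType R) := FSubspace {
  fscarrier :> vectType R ;
  fsincl : {linear fscarrier -> H} ;
  fsincl_inj : injective fsincl }.

Section Subspace.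
Context (R : realType) (H : normedModType R) (ip : {dot H for idfun}).
Variable V : fsubspace H.

Definition dotV (u v : V) : R := ip (fsincl V u) (fsincl V v).

Definition normV (v : V) : R := `|fsincl V v|.

End Subspace.

Arguments dotV {R H} ip V u v.
Arguments normV {R H} V v.

Definition opnorm (R : realType) (W : vectType R) (N : W -> R) (D : 'End(W))
  : R := sup [set N (D w) | w in [set w | N w <= 1]].

(* V (x) V in coordinates: the matrix A stands for the tensor
   \sum_(i, j) A i j *: (b_i (x) b_j), where b is the basis `vbasis {:V}`.
   The lemmas tens_span, tensop_tens and tdot_tens check that this is V (x) V,
   with the inner product and the operators D1 (x) D2 determined by their
   values on elementary tensors. *)
Section Tensor.
Context (R : realType) (V : vectType R).

Local Notation n := (\dim {:V}).
Local Notation b := (vbasis {:V}).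

Definition tspace : vectType R := 'M[R]_n.

Definition tens (v w : V) : tspace :=
  \matrix_(i, j) (coord b i v * coord b j w).

(* dV is the inner product of V *)
Definition tdot (dV : V -> V -> R) (A B : tspace) : R :=
  \sum_i \sum_j \sum_k \sum_l
    A i j * B k l * (dV b`_i b`_k * dV b`_j b`_l).

Definition tnorm (dV : V -> V -> R) (A : tspace) : R := Num.sqrt (tdot dV A A).

Definition tensop_fun (D1 D2 : 'End(V)) (A : tspace) : tspace :=
  \sum_i \sum_j A i j *: tens (D1 b`_i) (D2 b`_j).

Definition tensop (D1 D2 : 'End(V)) : 'End(tspace) := linfun (tensop_fun D1 D2).

Lemma tensop_fun_linear D1 D2 : linear (tensop_fun D1 D2).
Proof.
move=> a A B; rewrite /tensop_fun scaler_sumr -big_split; apply: eq_bigr => i _.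
rewrite /= scaler_sumr -big_split; apply: eq_bigr => j _ /=.
by rewrite !mxE scalerDl scalerA.
Qed.

HB.instance Definition _ D1 D2 :=
  GRing.isLinear.Build R tspace tspace *:%R (tensop_fun D1 D2)
    (@tensop_fun_linear D1 D2).

Lemma tens_linearl w : linear (tens^~ w).
Proof.
by move=> a u v; apply/matrixP => i j; rewrite !mxE linearP mulrDl mulrA.
Qed.

Lemma tens_linearr v : linear (tens v).
Proof.
move=> a u w; apply/matrixP => i j; rewrite !mxE linearP mulrDr.
by rewrite mulrCA.
Qed.

Lemma vbasis_coord (v : V) : v = \sum_i coord b i v *: b`_i.
Proof. exact/coord_vbasis/memvf. Qed.

Lemma tens_basis (i j : 'I_n) : tens b`_i b`_j = delta_mx i j.
Proof.
have fb : free b := basis_free (vbasisP _).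
apply/matrixP => k l; rewrite !mxE !coord_free //.
by rewrite -natrM mulnb (eq_sym k) (eq_sym l).
Qed.

Lemma tens_span (A : tspace) : A = \sum_i \sum_j A i j *: tens b`_i b`_j.
Proof.
rewrite [LHS]matrix_sum_delta; apply: eq_bigr => i _; apply: eq_bigr => j _.
by rewrite tens_basis.
Qed.

Lemma tensop_tens (D1 D2 : 'End(V)) (v w : V) :
  tensop D1 D2 (tens v w) = tens (D1 v) (D2 w).
Proof.
rewrite lfunE /=; apply/matrixP => k l; rewrite mxE.
rewrite [in RHS](vbasis_coord v) [in RHS](vbasis_coord w) !linear_sum /=.
rewrite big_distrlr summxE; apply: eq_bigr => i _.
rewrite summxE; apply: eq_bigr => j _.
by rewrite !linearZ !mxE /= mulrACA.
Qed.

End Tensor.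

Lemma tdot_tens (R : realType) (H : normedModType R) (ip : {dot H for idfun})
    (V : fsubspace H) (v1 v2 w1 w2 : V) :
  tdot (dotV ip V) (tens v1 v2) (tens w1 w2) =
  dotV ip V v1 w1 * dotV ip V v2 w2.
Proof.
have dotE (u u' : V) : dotV ip V u u' = \sum_i \sum_k
    coord (vbasis {:V}) i u * coord (vbasis {:V}) k u' *
    dotV ip V (vbasis {:V})`_i (vbasis {:V})`_k.
  rewrite {1}(vbasis_coord u) {1}(vbasis_coord u') /dotV.
  rewrite !(linear_sum (fsincl V)).
  rewrite linear_sumlz; apply: eq_bigr => i _; rewrite linear_sumr.
  apply: eq_bigr => k _.
  by rewrite !linearZ /= linearZl_LR /= mulrCA mulrA.
rewrite !dotE big_distrlr; apply: eq_bigr => i _; apply: eq_bigr => j _ /=.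
rewrite big_distrlr; apply: eq_bigr => k _; apply: eq_bigr => l _ /=.
by rewrite !mxE [RHS]mulrACA; congr (_ * _); rewrite mulrACA.
Qed.

Section OperatorNorms.
Context (R : realType) (H : normedModType R) (ip : {dot H for idfun}).
Variable V : fsubspace H.

(* the norm of L(V) *)
Definition normLV : 'End(V) -> R := opnorm (normV V).

(* the norm of L(V (x) V) *)
Definition normLVV : 'End(tspace V) -> R := opnorm (tnorm (dotV ip V)).

End OperatorNorms.

Arguments normLV {R H} V D.
Arguments normLVV {R H} ip V D.

Section FiniteDimensionalRandomVariables.
Context d (T : measurableType d) (R : realType) (P : probability T R).
Variables (W : vectType R) (N : W -> R).

Definition norm_open (A : set W) : Prop :=
  forall x, A x -> exists2 e, 0 < e & forall y, N (y - x) < e -> A y.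

(* X is measurable from the sigma-algebra G to the Borel sets of (W, N) *)
Definition measurable_wrt (G : set (set T)) (X : T -> W) : Prop :=
  forall B, <<s norm_open >> B -> G (X @^-1` B).

Definition Bochner_integrable (X : T -> W) : Prop :=
  measurable_wrt measurable X /\ ('E_P[N \o X] < +oo)%E.

Definition mean_square (X : T -> W) : \bar R := 'E_P[fun w => N (X w) ^+ 2].

(* X \in L^2(T; W), measurable with respect to G *)
Definition L2_wrt (G : set (set T)) (X : T -> W) : Prop :=
  measurable_wrt G X /\ (mean_square X < +oo)%E.

(* The W-valued integral, computed in coordinates; by Vint_linear it does not
   depend on the basis. *)
Definition Vint (A : set T) (X : T -> W) : W :=
  \sum_i (\int[P]_(w in A) coord (vbasis {:W}) i (X w)) *: (vbasis {:W})`_i.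

Lemma Vint_linear (A : set T) (X : T -> W) (f : {linear W -> R^o}) :
  measurable A ->
  (forall i, P.-integrable A (fun w => (coord (vbasis {:W}) i (X w))%:E)) ->
  f (Vint A X) = \int[P]_(w in A) f (X w).
Proof.
move=> mA iX.
have fX w : f (X w) =
    \sum_i coord (vbasis {:W}) i (X w) * f (vbasis {:W})`_i.
  rewrite [in LHS](vbasis_coord (X w)) linear_sum; apply: eq_bigr => i _.
  by rewrite linearZ.
rewrite /Vint linear_sum; under [RHS]eq_Rintegral do rewrite fX.
rewrite [RHS]/Rintegral.
have iXf i : P.-integrable A
    (fun w => (coord (vbasis {:W}) i (X w) * f (vbasis {:W})`_i)%:E).
  rewrite (_ : (fun _ => _) = fun w => ((coord (vbasis {:W}) i (X w))%:E *
    (f (vbasis {:W})`_i)%:E)%E) //; exact: integrableZr.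
under [in RHS]eq_integral do rewrite -sumEFin.
rewrite integral_sum // -sum_fine //; last first.
  by move=> i _; apply: integrable_fin_num.
apply: eq_bigr => i _; rewrite linearZ.
exact: esym (@RintegralZr _ _ _ _ _ (fun w => coord _ i (X w)) _ mA (iX i)).
Qed.

Definition expect (X : T -> W) : W := Vint setT X.

(* Y is a version of the conditional expectation E[X | G] *)
Definition is_cond_expect (G : set (set T)) (X Y : T -> W) : Prop :=
  [/\ Bochner_integrable X, measurable_wrt G Y, Bochner_integrable Y &
      forall A, G A -> Vint A Y = Vint A X].

End FiniteDimensionalRandomVariables.

(* The sigma-algebras F t matter for t >= 0 only. *)
Record usual_filtration d (T : measurableType d) (R : realType)
    (P : probability T R) (F : R -> set (set T)) : Prop := {
  filtration_sigma : forall t, 0 <= t -> sigma_algebra setT (F t) ;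
  filtration_sub : forall t, 0 <= t -> F t `<=` measurable ;
  filtration_mono : forall s t, 0 <= s -> s <= t -> F s `<=` F t ;
  filtration_right_continuous :
    forall t, 0 <= t -> \bigcap_(s in [set s | t < s]) F s = F t ;
  filtration_complete : P.-negligible `<=` F 0 }.

Section Recursion.
Context d (T : measurableType d) (R : realType) (P : probability T R).
Variables (V : vectType R) (N : V -> R) (F0 : set (set T)).
Variables (Ddet : 'End(V)) (Dstoch : nat -> T -> 'End(V)).

Fixpoint recursion (X0 : T -> V) (j : nat) : T -> V :=
  if j is j'.+1 then
    fun w => Ddet (recursion X0 j' w) + Dstoch j' w (recursion X0 j' w)
  else X0.

Lemma zero_solution j : recursion (cst 0) j = cst 0.
Proof. by elim: j => //= j ->; apply/funext => w /=; rewrite !linear0 addr0. Qed.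

(* stability of the zero solution, over F0-measurable initial conditions *)
Definition ms_stable : Prop :=
  forall eps : R, 0 < eps -> exists2 delta : R, 0 < delta &
    forall X0, L2_wrt P N F0 X0 -> (mean_square P N X0 < delta%:E)%E ->
    forall j, (mean_square P N (recursion X0 j) < eps%:E)%E.

Definition asymptotically_ms_stable : Prop :=
  ms_stable /\
  exists2 delta : R, 0 < delta &
    forall X0, L2_wrt P N F0 X0 -> (mean_square P N X0 < delta%:E)%E ->
    mean_square P N (recursion X0 j) @[j --> \oo] --> 0%E.

End Recursion.

(* S j \o ... \o S 0 *)
Fixpoint lfun_prod (R : realType) (W : vectType R) (S : nat -> 'End(W))
    (j : nat) : 'End(W) :=
  if j is j'.+1 then (S j \o lfun_prod S j')%VF else S 0%N.

(* Main.v *)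
Require Import Defs.
From HB Require Import structures.
From mathcomp Require Import all_boot all_order all_algebra.
From mathcomp Require Import all_classical all_reals all_analysis.
From mathcomp Require Import measurable_realfun ring lra.

Import Order.TTheory GRing.Theory Num.Theory.
Import numFieldNormedType.Exports.

Local Open Scope classical_set_scope.
Local Open Scope ring_scope.

(* The second moment tensor M_j = E[X^j (x) X^j] satisfies M_(j+1) = S_j M_j:
   in X^(j+1) (x) X^(j+1) the terms linear in D^(stoch,j) vanish because X^j is
   known at time t_j and D^(stoch,j) is centered given F_(t_j), and the
   quadratic term factorizes by (iii). Hence M_(j+1) = S_j ... S_0 M_0. In an
   orthonormal basis (e_p) of V_h, E|X^j|^2 is the sum of the n = dim V_h
   diagonal coefficients of M_j, so E|X^j|^2 <= n |M_j|, while
   |M_0| <= n^2 E|X^0|^2; therefore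
   E|X^(j+1)|^2 <= n^3 |S_j ... S_0| E|X^0|^2.
   For the square integrability of X^j, (iii) again gives
   E[D_kp^2 x_p^2] = E[D_kp^2] E[x_p^2] for the matrix entries D_kp of
   D^(stoch,j), first in [0, +oo]. *)

Definition functional {R : realType} {W : lmodType R} (g : W -> R^o)
    (gL : linear g) : {linear W -> R^o} :=
  HB.pack g (GRing.isLinear.Build R W R^o *:%R g gL).

(** * Gram-Schmidt for a symmetric positive definite bilinear form *)

Section GramSchmidt.
Context {R : realType} {W : vectType R} (s : W -> W -> R).
Hypothesis sL : forall v, linear (s^~ v : W -> R^o).
Hypothesis sC : forall u v, s u v = s v u.
Hypothesis s_gt0 : forall u, u != 0 -> 0 < s u u.

Let orthonormal (X : seq W) := forall i j, (i < size X)%N -> (j < size X)%N ->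
  s X`_i X`_j = (i == j)%:R.

Let sE (u v : W) : s u v = functional _ (sL v) u. Proof. by []. Qed.

Let s_suml (v : W) (I : finType) (F : I -> W) : s (\sum_i F i) v = \sum_i s (F i) v.
Proof. by rewrite sE linear_sum. Qed.

Let sZl a (u v : W) : s (a *: u) v = a * s u v.
Proof. by rewrite sE linearZ. Qed.

Let orthonormal_size X : orthonormal X -> (size X <= \dim {:W})%N.
Proof.
move=> oX; suff /eqP fX : free (in_tuple X).
  by rewrite /= in fX; rewrite -fX; apply/dimvS/subvf.
apply/freeP => k k0 i.
have : s (\sum_(i < size X) k i *: (in_tuple X)`_i) X`_i = 0.
  by rewrite k0 sE linear0.
rewrite s_suml (bigD1 i)//= big1 => [|j ji]; rewrite sZl oX//.
  by rewrite eqxx mulr1 addr0.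
by rewrite (inj_eq val_inj) (negbTE ji) mulr0.
Qed.

(** The residual of [w] after projection onto the span of [X] is nonzero and orthogonal to [X]; the
    new vector is this residual, normalized. *)
Let orthonormal_extend X w : orthonormal X ->
  w != \sum_(i < size X) s w X`_i *: X`_i ->
  exists u, orthonormal (u :: X).
Proof.
move=> oX; rewrite -subr_eq0; set u := w - _ => u0.
have uX j : (j < size X)%N -> s u X`_j = 0.
  move=> jX; rewrite sE linearB/= s_suml (bigD1 (Ordinal jX))//= big1.
    by rewrite addr0 sZl oX// eqxx mulr1 subrr.
  move=> i ij; rewrite sZl oX// (_ : (i : nat) == j = false) ?mulr0//.
  by apply: contra_neqF ij => /eqP ij; apply/val_inj.
have su := s_gt0 _ u0; pose c := Num.sqrt (s u u).
have c0 : 0 < c by rewrite sqrtr_gt0.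
exists (c^-1 *: u) => -[|i] [|j] /=; rewrite ?ltnS => iX jX.
- rewrite sZl sC sZl mulrA -expr2 exprVn sqr_sqrtr ?ltW//.
  by rewrite mulVf ?gt_eqF.
- by rewrite sZl uX// mulr0.
- by rewrite sC sZl uX// mulr0.
- by rewrite oX.
Qed.

(** If no orthonormal family reproduced every vector, each one could be extended, eventually beyond
    the dimension. *)
Lemma orthonormal_basis_exists : exists X : seq W,
  (forall i j, (i < size X)%N -> (j < size X)%N -> s X`_i X`_j = (i == j)%:R) /\
  forall w, w = \sum_(i < size X) s w X`_i *: X`_i.
Proof.
apply: contrapT => noX.
suff : exists2 X, orthonormal X & size X = (\dim {:W}).+1.
  by case=> X /orthonormal_size + sX; rewrite sX ltnn.
elim: (\dim _).+1 => [|k [X oX sX]]; first by exists [::].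
have /existsNP[w /eqP wX] : ~ forall w, w = \sum_(i < size X) s w X`_i *: X`_i.
  by move=> XE; apply: noX; exists X.
by have [u ?] := orthonormal_extend _ _ oX wX; exists (u :: X) => //=; rewrite sX.
Qed.

End GramSchmidt.

(** * Euclidean norms and operator norms in orthonormal coordinates *)

Section Coordinates.
Context {R : realType} {W : vectType R} {I : finType}.
Implicit Types (N : W -> R) (e : I -> W) (f : I -> {linear W -> R^o}).

(* [e] is an orthonormal basis for the Euclidean norm [N], with coordinate
   functionals [f] *)
Definition ortho_coords N e f : Prop :=
  [/\ forall w, w = \sum_i f i w *: e i, forall i j, f i (e j) = (i == j)%:R,
      forall w, 0 <= N w & forall w, N w ^+ 2 = \sum_i f i w ^+ 2].

(** Every linear functional is bounded with respect to [M]. Measurability and integrability of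
    vector-valued variables are transferred to scalar ones through this property alone; [C] is
    positive so that it can be divided by. *)
Definition dominating (U : lmodType R) (M : U -> R) : Prop :=
  forall g : {linear U -> R^o}, exists2 C, 0 < C &
    forall w, `|g w| <= C * M w.

Context {N e f} (Nef : ortho_coords N e f).

Lemma coord_le_norm i w : `|f i w| <= N w.
Proof.
have [_ _ N0 Nf] := Nef.
rewrite -(ler_pXn2r (ltn0Sn 1)) ?nnegrE// Nf real_normK ?num_real//.
by rewrite (bigD1 i)//= lerDl sumr_ge0// => j _; rewrite sqr_ge0.
Qed.

Lemma norm_le_sum_coord w : N w <= \sum_i `|f i w|.
Proof.
have [_ _ N0 Nf] := Nef.
have s0 : 0 <= \sum_i `|f i w| by apply: sumr_ge0.
rewrite -(ler_pXn2r (ltn0Sn 1)) ?nnegrE// Nf expr2 big_distrl/=.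
apply: ler_sum => i _; rewrite -real_normK ?num_real// expr2 ler_wpM2l//.
by rewrite (bigD1 i)//= lerDl sumr_ge0.
Qed.

Lemma linear_coordE (U : lmodType R) (g : {linear W -> U}) w :
  g w = \sum_i f i w *: g (e i).
Proof.
have [ew _ _ _] := Nef; rewrite {1}(ew w) linear_sum.
by apply: eq_bigr => i _; rewrite linearZ.
Qed.

Lemma norm_dominating : dominating W N.
Proof.
move=> g; exists (1 + \sum_i `|g (e i)|).
  by rewrite ltr_pwDl// sumr_ge0.
move=> w; have [_ _ N0 _] := Nef.
rewrite mulrDl mul1r -[leLHS]add0r lerD//.
rewrite linear_coordE mulr_suml (le_trans (ler_norm_sum _ _ _))//.
by apply: ler_sum => i _; rewrite normrM mulrC ler_wpM2l// coord_le_norm.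
Qed.

Lemma opnorm_ge (D : 'End(W)) w : N (D w) <= opnorm N D * N w.
Proof.
have [ew _ N0 Nf] := Nef.
have NZ a u : N (a *: u) = `|a| * N u.
  apply/eqP; rewrite -(eqrXn2 (ltn0Sn 1)) ?mulr_ge0//.
  rewrite exprMn !Nf mulr_sumr real_normK ?num_real//; apply/eqP.
  by apply: eq_bigr => i _; rewrite linearZ exprMn.
(* A [sup] bounds the elements of a set only if the set is bounded above; this crude constant, the
   sum of the absolute matrix entries of [D], provides the bound. *)
pose C := \sum_j \sum_i `|f j (D (e i))|.
have DC u : N (D u) <= C * N u.
  rewrite (le_trans (norm_le_sum_coord _))// mulr_suml; apply: ler_sum => j _.
  rewrite (linear_coordE _ D) linear_sum mulr_suml.
  rewrite (le_trans (ler_norm_sum _ _ _))//; apply: ler_sum => i _.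
  by rewrite linearZ normrM mulrC ler_wpM2l// coord_le_norm.
have C0 : 0 <= C by apply: sumr_ge0 => j _; apply: sumr_ge0.
(* A vector of norm zero cannot be normalized, but [DC] already settles it. *)
have [w0|] := eqVneq (N w) 0.
  by rewrite w0 mulr0 (le_trans (DC w))// w0 mulr0.
rewrite neq_lt ltNge N0 /= => w0.
have -> : N (D w) = N (D ((N w)^-1 *: w)) * N w.
  by rewrite linearZ NZ ger0_norm ?invr_ge0// mulrAC mulVf ?gt_eqF// mul1r.
rewrite ler_wpM2r//; apply: ub_le_sup; last first.
  by exists ((N w)^-1 *: w) => //=; rewrite NZ ger0_norm ?invr_ge0// mulVf ?gt_eqF.
exists C => _ [u /= u1 <-]; apply: le_trans (DC u) _.
by rewrite -[leRHS]mulr1 ler_wpM2l.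
Qed.

Lemma opnorm_ge0 (D : 'End(W)) : 0 <= opnorm N D.
Proof.
have [_ _ N0 Nf] := Nef.
have N00 : N 0 = 0.
  apply/eqP; rewrite -sqrf_eq0 Nf big1// => i _.
  by rewrite linear0 expr0n.
have ub : has_ubound [set N (D w) | w in [set w | N w <= 1]].
  (* The sign of [opnorm N D] is what is being proved, hence the maximum with [0]. *)
  exists (Num.max (opnorm N D) 0) => _ [u /= u1 <-].
  rewrite (le_trans (opnorm_ge _ _))//.
  have [c0|c0] := leP 0 (opnorm N D).
    by rewrite -[leRHS]mulr1 ler_wpM2l.
  by rewrite nmulr_rle0.
apply: ub_le_sup => //; exists 0; first by rewrite /= N00 ler01.
by rewrite linear0.
Qed.

Lemma opnorm_dominating : dominating 'End(W) (opnorm N).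
Proof.
move=> g.
have E_lin i k : linear (fun w => f i w *: e k).
  by move=> a u v; rewrite linearP scalerDl scalerA.
(* The matrix unit that sends [e i] to [e k] and the other basis vectors to zero. The coefficient of
   [D] on it is [f k (D (e i))], which is at most [opnorm N D * N (e i)] in absolute value. *)
pose E i k : 'End(W) := linfun
  (HB.pack (fun w => f i w *: e k)
     (GRing.isLinear.Build R W W *:%R _ (E_lin i k)) : {linear W -> W}).
have DE (D : 'End(W)) : D = \sum_i \sum_k f k (D (e i)) *: E i k.
  apply/lfunP => w; rewrite sum_lfunE (linear_coordE _ D).
  apply: eq_bigr => i _; rewrite sum_lfunE.
  have [ew _ _ _] := Nef; rewrite /= [in LHS](ew (D (e i))) scaler_sumr.
  apply: eq_bigr => k _; rewrite scale_lfunE lfunE/=.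
  by rewrite !scalerA mulrC.
pose C := \sum_i \sum_k N (e i) * `|g (E i k)|.
have [_ _ N0 _] := Nef.
exists (1 + C).
  by rewrite ltr_pwDl// sumr_ge0// => i _; rewrite sumr_ge0// => k _; rewrite mulr_ge0.
move=> D; rewrite mulrDl mul1r -[leLHS]add0r lerD ?opnorm_ge0//.
rewrite [in leLHS](DE D) linear_sum mulr_suml (le_trans (ler_norm_sum _ _ _))//.
apply: ler_sum => i _; rewrite linear_sum mulr_suml.
rewrite (le_trans (ler_norm_sum _ _ _))//; apply: ler_sum => k _.
rewrite linearZ normrM mulrAC ler_wpM2r//.
by rewrite mulrC (le_trans (coord_le_norm _ _))// opnorm_ge.
Qed.

End Coordinates.

(** * Orthonormal coordinates on the subspace and on its tensor square *)

Section OrthoCoordsTensor.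
Context {R : realType} {H : normedModType R} (ip : {dot H for idfun}).
Hypothesis ip_norm : forall u : H, `|u| ^+ 2 = ip u u.
Variable V : fsubspace H.

Let dotC (u v : V) : dotV ip V u v = dotV ip V v u.
Proof. by rewrite /dotV hermC/= expr0 mul1r. Qed.

Let dotL (v : V) : linear ((dotV ip V)^~ v : V -> R^o).
Proof. by move=> a u w; rewrite /dotV linearP/= linearPl. Qed.

(** Gram-Schmidt applies to [dotV], whose definiteness comes from the injectivity of the inclusion
    into [H]. *)
Lemma ortho_coords_subspace : exists (n : nat) (e : 'I_n -> V)
  (f : 'I_n -> {linear V -> R^o}),
  ortho_coords (normV V) e f /\
  forall u v, dotV ip V u v = \sum_i f i u * f i v.
Proof.
have dot_gt0 (u : V) : u != 0 -> 0 < dotV ip V u u.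
  move=> u0; rewrite /dotV -ip_norm exprn_gt0// normr_gt0.
  by apply: contra_neq u0 => u0; apply: (@fsincl_inj _ _ V); rewrite u0 linear0.
have [X [oX XE]] := orthonormal_basis_exists _ dotL dotC dot_gt0.
exists (size X), (fun i => X`_i), (fun i => functional _ (dotL X`_i)).
have dotE u v : dotV ip V u v =
    \sum_(i < size X) dotV ip V u X`_i * dotV ip V v X`_i.
  rewrite [in LHS](XE u) (_ : dotV ip V _ _ =
    functional _ (dotL v) (\sum_(i < size X) dotV ip V u X`_i *: X`_i))//.
  rewrite linear_sum; apply: eq_bigr => i _; rewrite linearZ/=.
  by rewrite (dotC v).
split => //; split => //.
- by move=> i j; rewrite /= oX// eq_sym.
- by move=> w; rewrite /normV.
- by move=> w; rewrite /normV ip_norm -/(dotV ip V w w) dotE.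
Qed.

Lemma ortho_coords_tensor (n : nat) (e : 'I_n -> V)
    (f : 'I_n -> {linear V -> R^o}) :
  ortho_coords (normV V) e f ->
  (forall u v, dotV ip V u v = \sum_i f i u * f i v) ->
  exists f2 : 'I_n * 'I_n -> {linear tspace V -> R^o},
    ortho_coords (tnorm (dotV ip V)) (fun ij => tens (e ij.1) (e ij.2)) f2 /\
    forall ij v w, f2 ij (tens v w) = f ij.1 v * f ij.2 w.
Proof.
move=> [ew fe _ _] dotE; pose b := vbasis {:V}.
(* The entries of [A] are coefficients on the tensors of [vbasis], not of [e]; this is the linear
   extension of the product of [f pq.1] and [f pq.2] from those tensors. *)
pose f2 (pq : 'I_n * 'I_n) (A : tspace V) : R^o :=
  \sum_i \sum_j A i j * (f pq.1 b`_i * f pq.2 b`_j).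
have f2L pq : linear (f2 pq).
  move=> a A B; rewrite /f2 scaler_sumr -big_split; apply: eq_bigr => i _ /=.
  rewrite scaler_sumr -big_split; apply: eq_bigr => j _ /=.
  by rewrite !mxE mulrDl -mulrA.
have f2_tens pq v w : f2 pq (tens v w) = f pq.1 v * f pq.2 w.
  rewrite [in RHS](vbasis_coord v) [in RHS](vbasis_coord w) !linear_sum/=.
  rewrite big_distrlr; apply: eq_bigr => i _; apply: eq_bigr => j _.
  by rewrite mxE !linearZ/= mulrACA.
exists (fun pq => functional _ (f2L pq)); split; last by move=> *; apply: f2_tens.
have tdotE A : tdot (dotV ip V) A A = \sum_pq f2 pq A ^+ 2.
  (* Parseval in each factor turns the product of two inner products into a sum over [pq], which is
     then moved outermost. *)
  transitivity (\sum_i \sum_j \sum_k \sum_l \sum_(pq : 'I_n * 'I_n)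
     (A i j * (f pq.1 b`_i * f pq.2 b`_j)) * (A k l * (f pq.1 b`_k * f pq.2 b`_l))).
    apply: eq_bigr => i _; apply: eq_bigr => j _; apply: eq_bigr => k _.
    apply: eq_bigr => l _; rewrite !dotE big_distrlr/= pair_bigA mulr_sumr.
    by apply: eq_bigr => pq _ /=; ring.
  under eq_bigr do under eq_bigr do under eq_bigr do rewrite exchange_big.
  under eq_bigr do under eq_bigr do rewrite exchange_big.
  under eq_bigr do rewrite exchange_big.
  rewrite exchange_big; apply: eq_bigr => pq _ /=.
  rewrite expr2 /f2 mulr_suml; apply: eq_bigr => i _.
  rewrite mulr_suml; apply: eq_bigr => j _.
  rewrite mulr_sumr; apply: eq_bigr => k _.
  by rewrite mulr_sumr; apply: eq_bigr => l _.
split; last first.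
- by move=> A; rewrite /tnorm sqr_sqrtr tdotE// sumr_ge0// => pq _; rewrite sqr_ge0.
- by move=> A; rewrite sqrtr_ge0.
- move=> [i j] [k l] /=; rewrite f2_tens !fe -natrM mulnb.
  by congr (_ %:R); rewrite xpair_eqE.
move=> A; rewrite [LHS]tens_span.
transitivity (\sum_i \sum_j \sum_(pq : 'I_n * 'I_n)
    (A i j * (f pq.1 b`_i * f pq.2 b`_j)) *: (tens (e pq.1) (e pq.2) : tspace V)).
  apply: eq_bigr => i _; apply: eq_bigr => j _.
  under eq_bigr do rewrite -scalerA.
  rewrite -scaler_sumr; congr (_ *: _).
  rewrite [in LHS](ew b`_i) [in LHS](ew b`_j) -/b.
  apply/matrixP => k l; rewrite mxE !linear_sum big_distrlr/= pair_bigA summxE.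
  by apply: eq_bigr => pq _; rewrite !mxE !linearZ /= mulrACA.
under [RHS]eq_bigr => pq _.
  rewrite /= /f2 scaler_suml; under eq_bigr do rewrite scaler_suml.
  over.
rewrite [RHS]exchange_big; apply: eq_bigr => i _.
by rewrite [RHS]exchange_big.
Qed.

End OrthoCoordsTensor.

(** Passing to the sigma-algebra generated by [G] makes the domain a measurable type; for a
    sigma-algebra [G] it is [G] itself. *)
Definition measurable_from {d} {T : measurableType d} {R : realType}
    (G : set (set T)) (Y : T -> R) : Prop :=
  measurable_fun [set: g_sigma_algebraType G] (Y : g_sigma_algebraType G -> R).

(** * Integrals of products with a factor measurable with respect to a sub-sigma-algebra *)

Section SubSigmaAlgebra.
Import HBNNSimple.
Context {d} {T : measurableType d} {R : realType} {P : probability T R}.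
Context {G : set (set T)}.
Hypothesis (Gsigma : sigma_algebra setT G) (Gsub : G `<=` measurable).
Implicit Types Y : T -> R.

Let sub_measurable (A : set T) : G.-sigma.-measurable A -> measurable A.
Proof. by rewrite measurable_g_measurableTypeE//; apply: Gsub. Qed.

Lemma measurable_fromW Y : measurable_from G Y -> measurable_fun setT Y.
Proof. by move=> mY _ B mB; apply: sub_measurable; exact: (mY measurableT B mB). Qed.

Lemma measurable_from_functional {W : vectType R} {N : W -> R} (X : T -> W)
    (g : {linear W -> R^o}) :
  dominating W N -> measurable_wrt N G X -> measurable_from G (g \o X).
Proof.
move=> /(_ g)[C C0 gC] mX.
apply: (measurability _ (RGenOInfty.measurableE R)) => _ [_ [a ->] <-] /=.
(* A dominated functional is Lipschitz, so the preimage of an open half-line is [norm_open]: around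
   [x] the ball of radius [(g x - a) / C] stays inside. *)
rewrite setTI measurable_g_measurableTypeE//.
apply: (mX (g @^-1` `]a, +oo[)); apply: sub_sigma_algebra => x /=.
rewrite in_itv/= andbT => agx; exists ((g x - a) / C).
  by rewrite divr_gt0// subr_gt0.
move=> y; rewrite ltr_pdivlMr// mulrC => yx; rewrite in_itv/= andbT.
have := le_lt_trans (gC _) yx.
by rewrite linearB/= ltr_norml opprB ltrBrDr subrK => /andP[].
Qed.

Lemma ge0_le_expectation_fin Y (Z : T -> R) (C : R) :
  measurable_fun setT Y -> 0 < C -> (forall w, `|Y w| <= C * Z w) ->
  ('E_P[Z] < +oo)%E -> P.-integrable setT (EFin \o Y).
Proof.
move=> mY C0 YZ; rewrite unlock => Zoo.
(* [Z] is not known to be measurable. The integral of a nonnegative function is a supremum over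
   simple functions below it, so it is still monotone when [C^-1 * |Y|] is compared with [Z]. *)
have mYC : measurable_fun setT (fun w => C^-1 * `|Y w|).
  by apply: measurable_funM => //; apply: measurableT_comp.
have iYC : P.-integrable setT (EFin \o (fun w => C^-1 * `|Y w|)).
  apply/integrableP; split; first exact/measurable_EFinP.
  apply: le_lt_trans Zoo; rewrite !ge0_integralTE//.
  - apply: ge_ereal_sup => _ [h /= hY <-]; apply: ereal_sup_ubound.
    exists h => //= w; apply: le_trans (hY w) _.
    rewrite lee_fin normrM normr_id gtr0_norm ?invr_gt0//.
    by rewrite ler_pdivrMl.
  - move=> w; rewrite lee_fin -(pmulr_rge0 _ C0).
    exact: le_trans (YZ w).
apply: (le_integrable measurableT _ _ (integrableZl measurableT C iYC)).
  exact/measurable_EFinP.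
move=> w _ /=; rewrite lee_fin mulrA divff ?gt_eqF// mul1r normr_id//.
Qed.

(** The level sets of [h] lie in [G], and on each of them [g1] and [g2] have the same integral. *)
Lemma integral_simple_eq (g1 g2 : T -> R)
    (h : {nnsfun g_sigma_algebraType G >-> R}) :
  P.-integrable setT (EFin \o g1) -> P.-integrable setT (EFin \o g2) ->
  (forall w, 0 <= g1 w) -> (forall w, 0 <= g2 w) ->
  (forall A, G A -> \int[P]_(w in A) g1 w = \int[P]_(w in A) g2 w) ->
  (\int[P]_w (g1 w * h w)%:E = \int[P]_w (g2 w * h w)%:E)%E.
Proof.
move=> i1 i2 g1_ge0 g2_ge0 g12.
pose A y := (h : T -> R) @^-1` [set y].
have GA y : G (A y).
  have : G.-sigma.-measurable (A y) by apply: measurable_sfunP.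
  by rewrite measurable_g_measurableTypeE.
have simpleE (g : T -> R) : P.-integrable setT (EFin \o g) -> (forall w, 0 <= g w) ->
    (\int[P]_w (g w * h w)%:E =
     \sum_(y \in range h) y%:E * \int[P]_(w in A y) (g w)%:E)%E.
  move=> ig g0; have mg : measurable_fun setT g.
    by case/integrableP : ig => /measurable_EFinP.
  transitivity (\int[P]_w (\sum_(y \in range h) (y * (g w * \1_(A y) w))%:E))%E.
    apply: eq_integral => w _; rewrite {1}fimfunE fsumEFin//.
    congr EFin; rewrite mulr_fsumr//; apply: eq_fsbigr => y _.
    by rewrite mulrCA.
  rewrite ge0_integral_fsum//; last 2 first.
  - move=> y; apply/measurable_EFinP; apply: measurable_funM => //.
    apply: measurable_funM => //.
    exact/measurable_indic/Gsub.
  - move=> y w _; rewrite lee_fin mulrCA mulr_ge0//.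
    rewrite /A indicE; have [/set_mem <-|_] := boolP (w \in _).
      by rewrite mulr1.
    by rewrite mulr0.
  apply: eq_fsbigr => y _.
  have mA : measurable (A y) by apply: Gsub.
  have gAE : (EFin \o (fun w => g w * \1_(A y) w)) = (EFin \o g) \_ (A y).
    by rewrite epatch_indic; apply/funext => w /=; rewrite EFinM.
  under eq_integral do rewrite EFinM.
  have igA : P.-integrable setT (EFin \o (fun w => g w * \1_(A y) w)).
    rewrite gAE; apply/(integrable_mkcond _ mA).1.
    exact: (integrableS measurableT mA (@subsetT _ _) ig).
  rewrite integralZl//.
  by rewrite [in RHS]integral_mkcond -gAE.
rewrite !simpleE//; apply: eq_fsbigr => y _; congr (_ * _)%E.
have mA : measurable (A y) by apply: Gsub.
have fin (g : T -> R) : P.-integrable setT (EFin \o g) ->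
    (\int[P]_(w in A y) (g w)%:E)%E \is a fin_num.
  move=> ig; apply: integrable_fin_num => //.
  exact: (integrableS measurableT mA (@subsetT _ _) ig).
by rewrite -(fineK (fin _ i1)) -(fineK (fin _ i2)); congr EFin; apply: g12.
Qed.

(** Monotone convergence along simple [G]-measurable approximations of [Y]. The equality is in
    [0, +oo], so it can serve to prove that the products are integrable. *)
Lemma expectation_eq_mul_ge0 (g1 g2 Y : T -> R) :
  P.-integrable setT (EFin \o g1) -> P.-integrable setT (EFin \o g2) ->
  (forall w, 0 <= g1 w) -> (forall w, 0 <= g2 w) ->
  (forall A, G A -> \int[P]_(w in A) g1 w = \int[P]_(w in A) g2 w) ->
  measurable_from G Y -> (forall w, 0 <= Y w) ->
  (\int[P]_w (g1 w * Y w)%:E = \int[P]_w (g2 w * Y w)%:E)%E.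
Proof.
move=> i1 i2 g1_ge0 g2_ge0 g12 mY Y0.
have mYE : measurable_fun [set: g_sigma_algebraType G]
    (EFin \o Y : g_sigma_algebraType G -> \bar R) by apply/measurable_EFinP.
pose h := nnsfun_approx measurableT mYE.
have limE (g : T -> R) : P.-integrable setT (EFin \o g) -> (forall w, 0 <= g w) ->
    (\int[P]_w (g w * Y w)%:E = limn (fun n => \int[P]_w (g w * h n w)%:E))%E.
  move=> ig g0; have mg : measurable_fun setT g.
    by case/integrableP : ig => /measurable_EFinP.
  rewrite -monotone_convergence//.
  - apply: eq_integral => w _; apply/esym/cvg_lim => //.
    under eq_fun do rewrite EFinM.
    rewrite EFinM; apply: cvgeZl => //.
    by apply: (cvg_nnsfun_approx measurableT mYE) => // ? _; rewrite lee_fin.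
  - move=> n; apply/measurable_EFinP/measurable_funM => //.
    apply: measurable_fromW; exact: measurable_funPT.
  - by move=> n w _; rewrite lee_fin mulr_ge0.
  - move=> w _ m n mn; rewrite lee_fin ler_wpM2l//.
    by have /lefP := nd_nnsfun_approx measurableT mYE mn; apply.
rewrite !limE//; congr (limn _); apply/funext => n.
exact: integral_simple_eq.
Qed.

(** The third hypothesis says that [g] has constant conditional expectation [c] given [G]. Replacing
    [g] by [c] shows that the integral of the product is [c] times that of [Y], hence finite. *)
Lemma integrable_mul_ge0 (g Y : T -> R) (c : R) :
  P.-integrable setT (EFin \o g) -> (forall w, 0 <= g w) ->
  (forall A, G A -> \int[P]_(w in A) g w = c * fine (P A)) ->
  measurable_from G Y -> (forall w, 0 <= Y w) ->
  P.-integrable setT (EFin \o Y) ->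
  P.-integrable setT (EFin \o (fun w => g w * Y w)).
Proof.
move=> ig g0 gc mY Y0 iY.
have GT : G setT by rewrite -(measurable_g_measurableTypeE Gsigma).
have c0 : 0 <= c.
  have := gc _ GT; rewrite probability_setT mulr1 => <-.
  exact: Rintegral_ge0.
have ic : P.-integrable setT (EFin \o cst c).
  by apply: finite_measure_integrable_cst.
apply/integrableP; split.
  apply/measurable_EFinP/measurable_funM; last exact: measurable_fromW.
  by case/integrableP : ig => /measurable_EFinP.
under eq_integral do rewrite /= ger0_norm ?mulr_ge0//.
rewrite (expectation_eq_mul_ge0 g (cst c))//.
  under eq_integral do rewrite EFinM.
  by rewrite integralZl// ltey_eq fin_numM// integrable_fin_num.
move=> A GA; rewrite gc// Rintegral_cst//; exact: Gsub.
Qed.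

(* Adding [`|g| + `|c|] to [g] and to [c] reduces the claim to nonnegative
   functions. *)
Lemma expectation_mul_ge0 (g Y : T -> R) (c : R) :
  P.-integrable setT (EFin \o g) ->
  (forall A, G A -> \int[P]_(w in A) g w = c * fine (P A)) ->
  measurable_from G Y -> (forall w, 0 <= Y w) ->
  P.-integrable setT (EFin \o Y) ->
  P.-integrable setT (EFin \o (fun w => g w * Y w)) ->
  \int[P]_w (g w * Y w) = c * \int[P]_w Y w.
Proof.
move=> ig gc mY Y0 iY igY.
have ic (k : R) : P.-integrable setT (EFin \o cst k).
  by apply: finite_measure_integrable_cst.
have ig_abs : P.-integrable setT (EFin \o (fun w => `|g w|)).
  exact: (integrable_abse ig).
pose b w := `|g w| + `|c|.
have ib : P.-integrable setT (EFin \o b).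
  exact: (integrableD measurableT ig_abs (ic _)).
pose g1 w := b w + g w; pose g2 w := b w + c.
have i1 : P.-integrable setT (EFin \o g1) by exact: (integrableD measurableT ib ig).
have i2 : P.-integrable setT (EFin \o g2) by exact: (integrableD measurableT ib (ic c)).
have ibY : P.-integrable setT (EFin \o (fun w => b w * Y w)).
  have iabs : P.-integrable setT (EFin \o (fun w => `|g w * Y w|)).
    exact: (integrable_abse igY).
  have := integrableD measurableT iabs (integrableZl measurableT `|c| iY).
  apply: eq_integrable => // w _ /=.
  by rewrite /b normrM (ger0_norm (Y0 w)) -EFinM -EFinD mulrDl.
have icY : P.-integrable setT (EFin \o (fun w => c * Y w)).
  exact: (integrableZl measurableT c iY).
have : \int[P]_w (g1 w * Y w) = \int[P]_w (g2 w * Y w).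
  congr fine; apply: expectation_eq_mul_ge0 => //.
  - move=> w; rewrite /g1 /b; have := ler_norm (- g w); rewrite normrN.
    by have := normr_ge0 c; lra.
  - move=> w; rewrite /g2 /b; have := ler_norm (- c); rewrite normrN.
    by have := normr_ge0 (g w); lra.
  - move=> A GA; have mA := Gsub _ GA.
    have iA k : P.-integrable setT k -> P.-integrable A k.
      exact: (integrableS measurableT mA (@subsetT _ _)).
    rewrite (RintegralD mA (iA _ ib) (iA _ ig)).
    by rewrite (RintegralD mA (iA _ ib) (iA _ (ic c))) gc// Rintegral_cst.
under eq_Rintegral do rewrite mulrDl.
under [X in _ = X -> _]eq_Rintegral do rewrite mulrDl.
rewrite (RintegralD measurableT ibY igY) (RintegralD measurableT ibY icY).
by move=> /addrI ->; rewrite RintegralZl.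
Qed.

Lemma expectation_mul (g Y : T -> R) (c : R) :
  P.-integrable setT (EFin \o g) ->
  (forall A, G A -> \int[P]_(w in A) g w = c * fine (P A)) ->
  measurable_from G Y ->
  P.-integrable setT (EFin \o Y) ->
  P.-integrable setT (EFin \o (fun w => g w * Y w)) ->
  \int[P]_w (g w * Y w) = c * \int[P]_w Y w.
Proof.
move=> ig gc mY iY igY.
have mg : measurable_fun setT g by case/integrableP : ig => /measurable_EFinP.
(* The positive and negative parts of [Y] remain [G]-measurable and are dominated by [Y], so the
   nonnegative case applies to each. *)
pose Yp := fun w => Num.max (Y w) 0; pose Yn := fun w => Num.max (- Y w) 0.
have YE w : Y w = Yp w - Yn w.
  by rewrite /Yp /Yn !maxEle; do 2 case: leP => ?; lra.
have YpY w : `|Yp w| <= `|Y w|.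
  by rewrite /Yp maxEle; case: (leP (Y w) 0); rewrite ?normr0.
have YnY w : `|Yn w| <= `|Y w|.
  by rewrite /Yn maxEle; case: (leP (- Y w) 0); rewrite ?normr0 ?normrN.
have mYp : measurable_from G Yp.
  by apply: measurable_maxr; [exact: mY|exact: measurable_cst].
have mYn : measurable_from G Yn.
  apply: measurable_maxr; last exact: measurable_cst.
  by apply: measurableT_comp => //; exact: mY.
have dom (Z : T -> R) : measurable_from G Z -> (forall w, `|Z w| <= `|Y w|) ->
    P.-integrable setT (EFin \o Z) /\
    P.-integrable setT (EFin \o (fun w => g w * Z w)).
  move=> mZ ZY; split.
    apply: (le_integrable measurableT _ _ iY).
      exact/measurable_EFinP/measurable_fromW.
    by move=> w _ /=; rewrite lee_fin.
  apply: (le_integrable measurableT _ _ igY).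
    by apply/measurable_EFinP/measurable_funM => //; apply: measurable_fromW.
  by move=> w _ /=; rewrite lee_fin !normrM ler_wpM2l.
have [iYp igYp] := dom _ mYp YpY; have [iYn igYn] := dom _ mYn YnY.
under eq_Rintegral do rewrite YE mulrBr.
rewrite RintegralB// !(expectation_mul_ge0 g _ c)//; last 2 first.
- by move=> w; rewrite /Yn le_max lexx orbT.
- by move=> w; rewrite /Yp le_max lexx orbT.
by rewrite -mulrBr -RintegralB//; under [in RHS]eq_Rintegral do rewrite YE.
Qed.

End SubSigmaAlgebra.

(** * Square-integrable real random variables *)

Section SquareIntegrable.
Context {d} {T : measurableType d} {R : realType} {P : probability T R}.
Implicit Types X Y : T -> R.

Definition square_integrable X : Prop :=
  measurable_fun setT X /\ P.-integrable setT (EFin \o (fun w => X w ^+ 2)).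

Lemma Rintegral_sum {I : Type} (s : seq I) (X : I -> T -> R) :
  (forall i, P.-integrable setT (EFin \o X i)) ->
  \int[P]_w (\sum_(i <- s) X i w) = \sum_(i <- s) \int[P]_w X i w.
Proof.
move=> iX; rewrite /Rintegral sum_fine => [|i _].
  rewrite -integral_sum//; congr fine; apply: eq_integral => w _.
  by rewrite sumEFin.
by apply: integrable_fin_num => //; exact: iX.
Qed.

Lemma square_integrable_mul X Y : square_integrable X -> square_integrable Y ->
  P.-integrable setT (EFin \o (fun w => X w * Y w)).
Proof.
move=> [mX iX] [mY iY].
apply: (le_integrable measurableT _ _ (integrableD measurableT iX iY)).
  exact/measurable_EFinP/measurable_funM.
move=> w _ /=; rewrite lee_fin [leRHS]ger0_norm ?addr_ge0 ?sqr_ge0//.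
rewrite normrM -(real_normK (num_real (X w))) -(real_normK (num_real (Y w))).
have := normr_ge0 (X w); have := normr_ge0 (Y w).
set a := `|X w|; set b := `|Y w| => b0 a0.
have := sqr_ge0 (a - b); rewrite sqrrB.
by have := mulr_ge0 a0 b0; rewrite -mulr_natl; lra.
Qed.

Lemma square_integrableD X Y : square_integrable X -> square_integrable Y ->
  square_integrable (fun w => X w + Y w).
Proof.
move=> X2 Y2; have [[mX iX] [mY iY]] := (X2, Y2).
split; first exact: measurable_funD.
have iXY := square_integrable_mul _ _ X2 Y2.
have := integrableD measurableT (integrableD measurableT iX iY)
  (integrableD measurableT iXY iXY).
apply: eq_integrable => // w _ /=; congr EFin; ring.
Qed.

Lemma square_integrableZ (a : R) X : square_integrable X ->
  square_integrable (fun w => a * X w).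
Proof.
move=> [mX iX]; split; first exact: measurable_funM.
have := integrableZl measurableT (a ^+ 2) iX.
by apply: eq_integrable => // w _ /=; rewrite exprMn.
Qed.

Lemma square_integrable_sum {I : Type} (s : seq I) (X : I -> T -> R) :
  (forall i, square_integrable (X i)) ->
  square_integrable (fun w => \sum_(i <- s) X i w).
Proof.
move=> X2; elim: s => [|i s IHs].
  under eq_fun do rewrite big_nil; split; first exact: measurable_cst.
  exact: finite_measure_integrable_cst.
under eq_fun do rewrite big_cons.
exact: square_integrableD.
Qed.

End SquareIntegrable.

Arguments square_integrable {d T R} P X.

(** * One step of the recursion for second moments, in coordinates *)

Section MomentRecursion.
Context {d} {T : measurableType d} {R : realType} {P : probability T R}.
Context {G : set (set T)} {I : finType}.
Hypothesis (Gsigma : sigma_algebra setT G) (Gsub : G `<=` measurable).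
(** Here [a] and [D] stand for the matrices of the deterministic and the stochastic operator, [K]
    for the coefficients of the expected tensor square of the latter, and [x] for the coordinates of
    the current iterate. *)
Context {a : I -> I -> R} {D : I -> I -> T -> R} {K : I -> I -> I -> I -> R}.
Context {x : I -> T -> R}.
Hypothesis iD : forall k p, P.-integrable setT (EFin \o D k p).
Hypothesis D0 : forall k p A, G A -> \int[P]_(w in A) D k p w = 0.
Hypothesis iDD : forall k p l q,
  P.-integrable setT (EFin \o (fun w => D k p w * D l q w)).
Hypothesis DDK : forall k p l q A, G A ->
  \int[P]_(w in A) (D k p w * D l q w) = K k p l q * fine (P A).
Hypothesis mx : forall p, measurable_from G (x p).
Hypothesis ix2 : forall p, square_integrable P (x p).

Let mD k p : measurable_fun setT (D k p).
Proof. by case/integrableP : (iD k p) => /measurable_EFinP. Qed.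

Let Dx2 k p : square_integrable P (fun w => D k p w * x p w).
Proof.
have [mxp ixp] := ix2 p; split; first exact: measurable_funM.
have DD0 w : 0 <= D k p w * D k p w by rewrite -expr2 sqr_ge0.
have := integrable_mul_ge0 Gsigma Gsub _ (fun w => x p w ^+ 2) _ (iDD k p k p)
  DD0 (DDK k p k p) (measurable_funX 2 (mx p)) (fun w => sqr_ge0 _) ixp.
by apply: eq_integrable => // w _ /=; rewrite exprMn.
Qed.

Let u k p w := (a k p + D k p w) * x p w.

Let u2 k p : square_integrable P (u k p).
Proof.
rewrite /u; under eq_fun do rewrite mulrDl.
by apply: square_integrableD => //; exact: square_integrableZ.
Qed.

Lemma square_integrable_step k :
  square_integrable P (fun w => \sum_p (a k p + D k p w) * x p w).
Proof. exact: (square_integrable_sum _ _ (u2 k)). Qed.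

Let expectation_uu k p l q :
  \int[P]_w (u k p w * u l q w) =
  (a k p * a l q + K k p l q) * \int[P]_w (x p w * x q w).
Proof.
have ixx := square_integrable_mul _ _ (ix2 p) (ix2 q).
have iDx := square_integrable_mul _ _ (Dx2 k p) (ix2 q).
have ixD := square_integrable_mul _ _ (Dx2 l q) (ix2 p).
have iDDx := square_integrable_mul _ _ (Dx2 k p) (Dx2 l q).
have mxx : measurable_from G (fun w => x p w * x q w).
  exact: measurable_funM (mx p) (mx q).
(* Four terms: the deterministic one, two linear in [D], and one quadratic in [D]. *)
have uuE w : u k p w * u l q w =
    (a k p * a l q) * (x p w * x q w) + a l q * (D k p w * x p w * x q w)
    + (a k p * (D l q w * x q w * x p w) + D k p w * x p w * (D l q w * x q w)).
  by rewrite /u; ring.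
under eq_Rintegral do rewrite uuE.
have iZ c (f : T -> R) : P.-integrable setT (EFin \o f) ->
    P.-integrable setT (EFin \o (fun w => c * f w)).
  by move=> /(integrableZl measurableT c).
have iA (f g : T -> R) : P.-integrable setT (EFin \o f) ->
    P.-integrable setT (EFin \o g) -> P.-integrable setT (EFin \o (fun w => f w + g w)).
  by move=> if_ ig; exact: (integrableD measurableT if_ ig).
rewrite (RintegralD measurableT (iA _ _ (iZ _ _ ixx) (iZ _ _ iDx))
  (iA _ _ (iZ _ _ ixD) iDDx)).
rewrite (RintegralD measurableT (iZ _ _ ixx) (iZ _ _ iDx)).
rewrite (RintegralD measurableT (iZ _ _ ixD) iDDx) !RintegralZl//.
(* A centered entry of [D] times a [G]-measurable product: this is [expectation_mul] with constant
   [0]. *)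
have zero k' p' p1 p2 : measurable_from G (fun w => x p1 w * x p2 w) ->
    P.-integrable setT (EFin \o (fun w => x p1 w * x p2 w)) ->
    P.-integrable setT (EFin \o (fun w => D k' p' w * x p1 w * x p2 w)) ->
    \int[P]_w (D k' p' w * x p1 w * x p2 w) = 0.
  move=> m12 i12 iD12; under eq_Rintegral do rewrite -mulrA.
  rewrite (expectation_mul Gsigma Gsub _ _ 0)// ?mul0r//.
    by move=> A GA; rewrite D0// mul0r.
  by apply: eq_integrable iD12 => // w _ /=; rewrite mulrA.
rewrite (zero k p p q)// (zero l q q p)//; last 2 first.
- exact: measurable_funM (mx q) (mx p).
- exact: square_integrable_mul.
have -> : \int[P]_w (D k p w * x p w * (D l q w * x q w)) =
    K k p l q * \int[P]_w (x p w * x q w).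
  under eq_Rintegral do rewrite mulrACA.
  apply: (expectation_mul Gsigma Gsub _ _ _ (iDD k p l q) (DDK k p l q)) => //.
  by apply: eq_integrable iDDx => // w _ /=; rewrite mulrACA.
by ring.
Qed.

Lemma second_moment_step k l :
  \int[P]_w ((\sum_p (a k p + D k p w) * x p w) *
             (\sum_p (a l p + D l p w) * x p w)) =
  \sum_p \sum_q (a k p * a l q + K k p l q) * \int[P]_w (x p w * x q w).
Proof.
under eq_Rintegral do rewrite big_distrlr/=.
have iuu p q := square_integrable_mul _ _ (u2 k p) (u2 l q).
rewrite Rintegral_sum => [|p].
  apply: eq_bigr => p _; rewrite Rintegral_sum => [|q]; last exact: iuu.
  by apply: eq_bigr => q _; rewrite -expectation_uu.
have := integrable_sum measurableT (index_enum I) (P := xpredT) (fun q _ => iuu p q).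
by apply: eq_integrable => // w _ /=; rewrite sumEFin.
Qed.

End MomentRecursion.

(** * Scalar consequences of vector-valued conditional expectations *)

Section CondExpectFunctional.
Context {d} {T : measurableType d} {R : realType} {P : probability T R}.
Context {G : set (set T)} {W : vectType R} {N : W -> R}.
Hypotheses (Gsub : G `<=` measurable) (Ndom : dominating W N).

Lemma integrable_functional (X : T -> W) (g : {linear W -> R^o}) :
  Bochner_integrable P N X -> P.-integrable setT (EFin \o (g \o X)).
Proof.
move=> [mX iX]; have [C C0 gC] := Ndom g.
apply: (ge0_le_expectation_fin _ (N \o X) C) => //.
  apply: (measurable_fromW (G := measurable)) => //.
    exact: sigma_algebra_measurable.
  by apply: measurable_from_functional mX => //; exact: sigma_algebra_measurable.
by move=> w; apply: gC.
Qed.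

(** Linear functionals commute with [Vint], so a constant conditional expectation of [X] yields one
    of [g \o X]. *)
Lemma cond_expect_functional (X : T -> W) (c : W) (g : {linear W -> R^o}) :
  is_cond_expect P N G X (fun=> c) ->
  P.-integrable setT (EFin \o (g \o X)) /\
  forall A, G A -> \int[P]_(w in A) g (X w) = g c * fine (P A).
Proof.
move=> [bX _ _ cX]; split; first exact: integrable_functional.
move=> A GA; have mA := Gsub _ GA.
have iA i : P.-integrable A (fun w => (coord (vbasis {:W}) i (X w))%:E).
  apply: (integrableS measurableT) => //.
  exact: (integrable_functional _ (coord (vbasis {:W}) i)).
rewrite -(Vint_linear g mA iA) -cX// Vint_linear ?Rintegral_cst// => i.
exact: finite_measure_integrable_cst.
Qed.

End CondExpectFunctional.

(** * The second moment tensor and the resulting mean-square bound *)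

Section SecondMomentTensor.
Context {d} {Omega : measurableType d} {R : realType} {P : probability Omega R}.
Context {V : vectType R} {I : finType} {N : V -> R} {N2 : tspace V -> R}.
Context {e : I -> V} {f : I -> {linear V -> R^o}}.
Context {f2 : I * I -> {linear tspace V -> R^o}}.
Hypothesis Nef : ortho_coords N e f.
Hypothesis N2ef : ortho_coords N2 (fun pq => tens (e pq.1) (e pq.2)) f2.
Hypothesis f2_tens : forall pq v w, f2 pq (tens v w) = f pq.1 v * f pq.2 w.
Context {F : nat -> set (set Omega)}.
Hypothesis F_sigma : forall j, sigma_algebra setT (F j).
Hypothesis F_sub : forall j, F j `<=` measurable.
Hypothesis F_mono : forall j, F j `<=` F j.+1.
Context {Ddet : 'End(V)} {Dstoch : nat -> Omega -> 'End(V)}.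
Hypothesis Dstoch_measurable :
  forall j, measurable_wrt (opnorm N) (F j.+1) (Dstoch j).
Hypothesis Dstoch_centered :
  forall j, is_cond_expect P (opnorm N) (F j) (Dstoch j) (fun=> 0).
Hypothesis Dstoch_tens : forall j,
  is_cond_expect P (opnorm N2) (F j)
    (fun w => tensop (Dstoch j w) (Dstoch j w))
    (fun=> expect P (fun w => tensop (Dstoch j w) (Dstoch j w))).

Let S j : 'End(tspace V) := tensop Ddet Ddet +
  expect P (fun w => tensop (Dstoch j w) (Dstoch j w)).

(** With [g] a coordinate functional and [u] a basis vector this is a matrix entry of [D]; it is
    stated as a function of [D] because it is used as a linear functional on operators. *)
Let entry (U : vectType R) (g : {linear U -> R^o}) (u : U) (D : 'End(U)) : R^o :=
  g (D u).

Let entryL U g u : linear (entry U g u).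
Proof. by move=> a D D'; rewrite /entry add_lfunE scale_lfunE linearP. Qed.

Let E j k p (w : Omega) : R := f k (Dstoch j w (e p)).

Let K j k p l q : R :=
  f2 (k, l) (expect P (fun w => tensop (Dstoch j w) (Dstoch j w))
    (tens (e p) (e q))).

Let E_centered j k p : P.-integrable setT (EFin \o E j k p) /\
  forall A, F j A -> \int[P]_(w in A) E j k p w = 0.
Proof.
have [iE E0] := cond_expect_functional (F_sub j) (opnorm_dominating Nef) _ _
  (functional _ (entryL _ (f k) (e p))) (Dstoch_centered j).
split=> // A FA; rewrite /E [LHS]E0//= /entry.
by rewrite lfunE/= linear0 mul0r.
Qed.

Let E_tens j k p l q :
  P.-integrable setT (EFin \o (fun w => E j k p w * E j l q w)) /\
  forall A, F j A ->
    \int[P]_(w in A) (E j k p w * E j l q w) = K j k p l q * fine (P A).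
Proof.
have [iE E0] := cond_expect_functional (F_sub j) (opnorm_dominating N2ef) _ _
  (functional _ (entryL _ (f2 (k, l)) (tens (e p) (e q)))) (Dstoch_tens j).
(* A product of two matrix entries is a single entry of the tensor square, hence a linear functional
   of the operator in (iii). *)
have EE w : E j k p w * E j l q w =
    f2 (k, l) (tensop (Dstoch j w) (Dstoch j w) (tens (e p) (e q))).
  by rewrite tensop_tens f2_tens.
split=> [|A FA].
  by apply: eq_integrable iE => // w _ /=; rewrite EE.
by under eq_Rintegral do rewrite EE; rewrite [LHS]E0.
Qed.

Let E_measurable j k p : measurable_from (F j.+1) (E j k p).
Proof.
exact: (measurable_from_functional (F_sigma _) _
  (functional _ (entryL _ (f k) (e p))) (opnorm_dominating Nef)
  (Dstoch_measurable j)).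
Qed.

Context {X0 : Omega -> V} (X0_L2 : L2_wrt P N (F 0%N) X0).

Let X := recursion Ddet Dstoch X0.
Let x j p (w : Omega) : R := f p (X j w).

Let x_step j k :
  x j.+1 k = fun w => \sum_p (f k (Ddet (e p)) + E j k p w) * x j p w.
Proof.
apply/funext => w; rewrite /x /X /= -/X linearD/=.
rewrite (linear_coordE Nef _ Ddet) (linear_coordE Nef _ (Dstoch j w)).
rewrite !linear_sum -big_split; apply: eq_bigr => p _ /=.
by rewrite !linearZ/= mulrDl; congr (_ + _); rewrite mulrC.
Qed.

(** Both properties go through one induction, since square integrability at the next step relies on
    adaptedness at the current one. *)
Let x_adapted j : (forall k, measurable_from (F j) (x j k)) /\
  forall k, square_integrable P (x j k).
Proof.
elim: j => [|j [mx x2]]; split => k.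
- exact: (measurable_from_functional (F_sigma _) _ _ (norm_dominating Nef) X0_L2.1).
- have mx0 := measurable_from_functional (F_sigma _) _ (f k)
    (norm_dominating Nef) X0_L2.1.
  have mx : measurable_fun setT (x 0%N k).
    exact: (measurable_fromW (F_sigma _) (F_sub _) _ mx0).
  split => //; apply: (ge0_le_expectation_fin _ (fun w => N (X0 w) ^+ 2) 1).
  + exact: measurable_funX.
  + exact: ltr01.
  + move=> w; rewrite mul1r normrX lerXn2r ?nnegrE// ?(coord_le_norm Nef)//.
    by have [_ _ ->] := Nef.
  + exact: X0_L2.2.
- rewrite x_step; apply: measurable_sum => p; apply: measurable_funM.
    by apply: measurable_funD; [exact: measurable_cst|exact: E_measurable].
  move=> _ B mB; have := mx p measurableT B mB.
  by rewrite !measurable_g_measurableTypeE//; apply: F_mono.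
- rewrite x_step.
  have iE l p := (E_centered j l p).1.
  have iEE l p m q := (E_tens j l p m q).1.
  have EEK l p m q := (E_tens j l p m q).2.
  exact: (square_integrable_step (a := fun k p => f k (Ddet (e p)))
    (F_sigma j) (F_sub j) iE iEE EEK mx x2).
Qed.

Let m j p q := \int[P]_w (x j p w * x j q w).

(** The tensor E[X^j (x) X^j], built from its coefficients in the orthonormal basis. *)
Let M j : tspace V := \sum_pq m j pq.1 pq.2 *: tens (e pq.1) (e pq.2).

Let f2M j pq : f2 pq (M j) = m j pq.1 pq.2.
Proof.
rewrite linear_sum (bigD1 pq)//= linearZ/=.
have [_ f2e _ _] := N2ef.
rewrite f2e eqxx /GRing.scale/= mulr1 big1 ?addr0// => rs rspq.
by rewrite linearZ/= f2e eq_sym (negbTE rspq) /GRing.scale/= mulr0.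
Qed.

Let m_step j k l : m j.+1 k l = \sum_p \sum_q
  (f k (Ddet (e p)) * f l (Ddet (e q)) + K j k p l q) * m j p q.
Proof.
rewrite /m !x_step; have [mx x2] := x_adapted j.
have iE l' p := (E_centered j l' p).1.
have E0 l' p := (E_centered j l' p).2.
have iEE l' p m' q := (E_tens j l' p m' q).1.
have EEK l' p m' q := (E_tens j l' p m' q).2.
exact: (second_moment_step (a := fun k p => f k (Ddet (e p)))
  (F_sigma j) (F_sub j) iE E0 iEE EEK mx x2).
Qed.

Let M_step j : M j.+1 = S j (M j).
Proof.
rewrite {2}/M linear_sum/=; have [Aw _ _ _] := N2ef.
(* Expanding the image under [S j] of each basis tensor leaves one identity per coefficient
   [(k, l)], namely [m_step]. *)
under [RHS]eq_bigr => pq _.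
  rewrite linearZ/= (Aw (S j _)) scaler_sumr; over.
rewrite [RHS]exchange_big/=; apply: eq_bigr => -[k l] _ /=.
under [RHS]eq_bigr do rewrite scalerA.
rewrite -scaler_suml; congr (_ *: _).
rewrite m_step pair_bigA; apply: eq_bigr => -[p q] _ /=.
rewrite /S add_lfunE linearD/= tensop_tens f2_tens mulrC//.
Qed.

(** The index is shifted because [lfun_prod S j] has [j.+1] factors. *)
Let M_prod j : M j.+1 = lfun_prod S j (M 0%N).
Proof.
elim: j => [|j IHj]; first by rewrite M_step.
by rewrite M_step IHj /= comp_lfunE.
Qed.

Let t j := \sum_p m j p p.

Let mean_squareE j : mean_square P N (X j) = (t j)%:E.
Proof.
have [_ x2] := x_adapted j; have [_ _ _ NX] := Nef.
rewrite /mean_square unlock.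
have ixx p := square_integrable_mul _ _ (x2 p) (x2 p).
under eq_integral => w _.
  rewrite NX -sumEFin; under eq_bigr do rewrite expr2; over.
rewrite integral_sum//= /t -sumEFin; apply: eq_bigr => p _.
by rewrite /m /Rintegral fineK//; apply: integrable_fin_num => //; exact: ixx.
Qed.

(** Pointwise, twice the product of two coordinates is at most the sum of their squares, and each
    square is at most the sum of all squares, whose integral is [t j]. *)
Let m_le j p q : `|m j p q| <= t j.
Proof.
have [_ x2] := x_adapted j.
have ixx r s := square_integrable_mul _ _ (x2 r) (x2 s).
apply: le_trans (le_normr_Rintegral measurableT (ixx p q)) _.
rewrite /t /m -Rintegral_sum; last by move=> r; exact: ixx.
apply: le_Rintegral => //; first exact: (integrable_abse (ixx p q)).
  have := integrable_sum measurableT (index_enum I) (P := xpredT) (fun r _ => ixx r r).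
  by apply: eq_integrable => // w _ /=; rewrite sumEFin.
move=> w _; have le_sq r : `|x j r w| ^+ 2 <= \sum_s x j s w * x j s w.
  rewrite real_normK ?num_real// (bigD1 r)//= -expr2 lerDl sumr_ge0// => s _.
  by rewrite -expr2 sqr_ge0.
rewrite normrM; have := sqr_ge0 (`|x j p w| - `|x j q w|).
have := le_sq p; have := le_sq q; rewrite sqrrB -mulr_natl.
set s := \sum_s _; set a := `|_|; set b := `|_|; lra.
Qed.

Lemma mean_square_recursion_le : exists t : nat -> R,
  [/\ forall j, mean_square P N (recursion Ddet Dstoch X0 j) = (t j)%:E,
      forall j, 0 <= t j &
      forall j, t j.+1 <= #|I|%:R ^+ 3 * opnorm N2 (lfun_prod S j) * t 0%N].
Proof.
exists t; split => //.
  move=> j; apply: sumr_ge0 => p _; apply: Rintegral_ge0 => w _.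
  by rewrite -expr2 sqr_ge0.
move=> j; have t_le : t j.+1 <= #|I|%:R * N2 (M j.+1).
  rewrite /t mulr_natl -sumr_const; apply: ler_sum => p _.
  rewrite -(f2M _ (p, p)); apply: le_trans (ler_norm _) _.
  exact: (coord_le_norm N2ef).
have M0_le : N2 (M 0%N) <= #|I|%:R ^+ 2 * t 0%N.
  apply: le_trans (norm_le_sum_coord N2ef _) _.
  rewrite -natrX mulr_natl expnS expn1 -card_prod -sumr_const.
  by apply: ler_sum => pq _; rewrite f2M.
have -> : #|I|%:R ^+ 3 * opnorm N2 (lfun_prod S j) * t 0%N =
  #|I|%:R * (opnorm N2 (lfun_prod S j) * (#|I|%:R ^+ 2 * t 0%N)) by ring.
apply: le_trans t_le _; rewrite ler_wpM2l//.
rewrite M_prod; apply: le_trans (opnorm_ge N2ef _ _) _.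
by rewrite ler_wpM2l// (opnorm_ge0 N2ef).
Qed.

End SecondMomentTensor.

(** * Stability deduced from the bound on the mean squares *)

Theorem theorem2p4
  (R : realType)
  (d : measure_display) (Omega : measurableType d) (P : probability Omega R)
  (P_complete : measure_is_complete P)
  (F : R -> set (set Omega)) (F_usual : usual_filtration P F)
  (* the real separable Hilbert space H, with inner product ip *)
  (H : completeNormedModType R) (ip : {dot H for idfun})
  (ip_norm : forall u : H, `|u| ^+ 2 = ip u u)
  (H_separable : separable_space H)
  (V : R -> fsubspace H) (h : R) (h_gt0 : 0 < h) (h_le1 : h <= 1)
  (dt : R) (dt_gt0 : 0 < dt)
  (Ddet : 'End(V h)) (Dstoch : nat -> Omega -> 'End(V h))
  (Dstoch_measurable : forall j : nat,
    measurable_wrt (normLV (V h)) (F (j.+1%:R * dt)) (Dstoch j))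
  (Dstoch_centered : forall j : nat,
    is_cond_expect P (normLV (V h)) (F (j%:R * dt)) (Dstoch j)
      (fun _ => 0))
  (Dstoch_L2 : forall j : nat,
    (mean_square P (normLV (V h)) (Dstoch j) < +oo)%E)
  (Dstoch_tens : forall j : nat,
    is_cond_expect P (normLVV ip (V h)) (F (j%:R * dt))
      (fun w => tensop (Dstoch j w) (Dstoch j w))
      (fun _ => expect P (fun w => tensop (Dstoch j w) (Dstoch j w)))) :
  let S := fun j : nat => tensop Ddet Ddet +
    expect P (fun w => tensop (Dstoch j w) (Dstoch j w)) in
  normLVV ip (V h) (lfun_prod S j) @[j --> \oo] --> (0 : R) ->
  asymptotically_ms_stable P (normV (V h)) (F 0) Ddet Dstoch.
Proof.
move=> S S0.
have [n [e [f [Nef dotE]]]] := ortho_coords_subspace ip ip_norm (V h).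
have [f2 [N2ef f2_tens]] := ortho_coords_tensor ip (V h) n e f Nef dotE.
pose L j := normLVV ip (V h) (lfun_prod S j).
have L_ge0 j : 0 <= L j := opnorm_ge0 N2ef _.
have jdt_ge0 j : 0 <= j%:R * dt by rewrite mulr_ge0// ltW.
have F_sigma j := filtration_sigma F_usual (jdt_ge0 j).
have F_sub j := filtration_sub F_usual (jdt_ge0 j).
have F_mono j : F (j%:R * dt) `<=` F (j.+1%:R * dt).
  by apply: (filtration_mono F_usual) => //; rewrite ler_pM2r// ler_nat.
have bound X0 : L2_wrt P (normV (V h)) (F 0) X0 -> exists t : nat -> R,
    [/\ forall j, mean_square P (normV (V h)) (recursion Ddet Dstoch X0 j) = (t j)%:E,
        forall j, 0 <= t j & forall j, t j.+1 <= n%:R ^+ 3 * L j * t 0%N].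
  move=> X0_L2; rewrite -[n in n%:R]card_ord.
  apply: (mean_square_recursion_le Nef N2ef f2_tens F_sigma F_sub F_mono) => //.
  (* Time zero appears as [0%:R * dt] in the sampled filtration. *)
  by rewrite mul0r.
have [B B0 LB] : exists2 B, 0 < B & forall j, n%:R ^+ 3 * L j <= B.
  have [B0 [_ LB]] := cvg_seq_bounded (cvgP _ S0).
  (* Boundedness holds with every constant strictly above [B0]; the maximum with [0] keeps the
     chosen one positive. *)
  pose B := Num.max B0 0 + 1; exists (n%:R ^+ 3 * B + 1).
    by rewrite ltr_wpDl// mulr_ge0// addr_ge0// le_max lexx orbT.
  move=> j; apply: ler_wpDr => //; rewrite ler_wpM2l//.
  apply: le_trans (ler_norm _) (LB B _ j I).
  by rewrite /B ltr_pwDr// le_max lexx.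
split.
(* The factor [B + 1] covers both the initial time, with factor [1], and all later times, with
   factor [B]. *)
- move=> eps eps0; exists (eps / (B + 1)); first by rewrite divr_gt0// addr_gt0.
  move=> X0 X0_L2; have [t [tE t0 tL]] := bound _ X0_L2.
  have := tE 0%N; rewrite /= => ->; rewrite lte_fin ltr_pdivlMr ?addr_gt0// => t0eps.
  move=> j; rewrite tE lte_fin; apply: le_lt_trans t0eps.
  rewrite mulrDr mulr1; case: j => [|j].
    by rewrite lerDr mulr_ge0// ltW.
  apply: le_trans (tL j) _; apply: ler_wpDr => //.
  by rewrite mulrC ler_wpM2l.
(* The bound is linear in [t 0], so convergence holds for any finite initial mean square and [1]
   serves as [delta]. *)
- exists 1 => // X0 X0_L2 _; have [t [tE t0 tL]] := bound _ X0_L2.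
  rewrite (_ : (fun j => _) = EFin \o t); last exact/funext.
  apply: cvg_EFin; first by near=> j.
  (* The bound concerns [t j.+1], so the sequence is shifted before it is squeezed between [0] and a
     multiple of [L j]. *)
  rewrite -cvg_shiftS; apply: (@squeeze_cvgr _ _ _ _ (cst 0)).
  + by near=> j; rewrite t0; exact: tL.
  + exact: cvg_cst.
  + rewrite -[X in _ --> X](mul0r (t 0%N)); apply: cvgMl.
    rewrite -[X in _ --> X](mulr0 (n%:R ^+ 3)); exact: cvgMr.
Unshelve. all: by end_near.
Qed.
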